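(* Let the numbers $p,\gamma,A,R,n$ satisfy $1<p\leq2$, $0<4\gamma<A<1$, $R\geq0$, and \[n>\frac{4(R+1)p}{\gamma(p-1)}A^{-p/(\gamma p-\gamma)}.\] If $G$ is a graph of order $n$ with $\lambda^{(p)}(G)\,n^{2/p-1}\geq An-R/n$ and $\delta(G)\leq(A-\gamma)n$, then there exists an induced subgraph $H\subset G$ of order $k>A^{p/(\gamma p-\gamma)}n$ with \[\lambda^{(p)}(H)\,k^{2/p-1}>Ak\quad\text{and}\quad\delta(H)>(A-\gamma)k.\]
   Context: For a graph $G$ with vertex set $\{1,\dots,n\}$ and real $p\geq1$, the $p$-spectral radius is $\lambda^{(p)}(G)=\max\{2\sum_{\{i,j\}\in E(G)}x_ix_j : x_1,\dots,x_n\in\mathbb{R},\ |x_1|^p+\cdots+|x_n|^p=1\}$. $\delta(G)$ denotes the minimum degree of $G$. *)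

(* Defs.v *)
From HB Require Import structures.
From mathcomp Require Import all_boot all_order all_algebra.
From mathcomp Require Import all_classical all_reals all_analysis.

Set Implicit Arguments.
Unset Strict Implicit.
Unset Printing Implicit Defensive.

Import Order.TTheory GRing.Theory Num.Theory.

Local Open Scope classical_set_scope.
Local Open Scope ring_scope.

(* Finite simple graphs; the order of G is #|G|. *)
Record sgraph : Type := SGraph {
  vertex :> finType;
  adj : rel vertex;
  adj_sym : symmetric adj;
  adj_irrefl : irreflexive adj
}.

Definition edges (G : sgraph) : {set {set G}} :=
  [set [set u.1; u.2]%SET | u : G * G & adj u.1 u.2]%SET.

Definition degree (G : sgraph) (v : G) : nat := #|[set w | adj v w]%SET|.

(* Every degree is smaller than #|G|, so the default value only matters for the
   empty graph, where it gives 0. *)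
Definition min_degree (G : sgraph) : nat := \big[minn/#|G|]_(v : G) degree v.

Section Induced.
Variables (G : sgraph) (S : {set G}).

Definition induced_adj : rel {v : G | v \in S} :=
  fun u v => adj (val u) (val v).

Lemma induced_adj_sym : symmetric induced_adj.
Proof. by move=> u v; rewrite /induced_adj adj_sym. Qed.

Lemma induced_adj_irrefl : irreflexive induced_adj.
Proof. by move=> u; rewrite /induced_adj adj_irrefl. Qed.

Definition induced_sgraph : sgraph := SGraph induced_adj_sym induced_adj_irrefl.

End Induced.

(* An edge e is a two-element set {i, j}, so the product over e is x i * x j. *)
Definition edge_form (R : realType) (G : sgraph) (x : G -> R) : R :=
  2 * \sum_(e in edges G) \prod_(i in e) x i.

(* For p >= 1 and #|G| > 0 the supremum is a maximum: edge_form is continuous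
   and the unit sphere of the p-norm is compact and nonempty. *)
Definition p_spectral_radius (R : realType) (p : R) (G : sgraph) : R :=
  sup [set edge_form x | x in [set x : G -> R | \sum_(i : G) `|x i| `^ p = 1]].

(* Main.v *)
(* Scale a nonnegative extremal vector y of a graph of order N so that
   sum y_i^p = N, and let a = lambda * N^(2/p - 2) be the normalised radius.
   Optimality gives the eigenvalue equations a N y_v^(p-1) = sum_(i ~ v) y_i.
   At a vertex v of degree at most (A - gamma) N, Young's inequality
   y <= y^p/p + 1 - 1/p turns them into sigma (1 + a - (A - gamma)) <= 1 for
   sigma = min y_i^p, so sigma stays away from 1 by about gamma.  Deleting the
   vertex u with y_u^p = sigma leaves a form of value a N (N - 2 sigma) and a
   vector of p-mass N - sigma, and hence increases the potential a N^theta, where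
   theta = gamma (p - 1) / p; the first deletion also makes up for the defect r/n^2.
   While vertices of low degree remain, repeat.  As a <= 1 and the potential exceeds
   A n^theta, the order stays above A^(1/theta) n, so the process stops. *)
Require Import Defs.
From HB Require Import structures.
From mathcomp Require Import all_boot all_order all_algebra.
From mathcomp Require Import all_classical all_reals all_analysis.
From mathcomp Require Import ring lra.

Set Implicit Arguments.
Unset Strict Implicit.
Unset Printing Implicit Defensive.

Import Order.TTheory GRing.Theory Num.Theory.
Import numFieldNormedType.Exports.

Local Open Scope ring_scope.

(** * The edge form and its nonnegative maximisers *)

(** Exactly two ordered pairs, (a, b) and (b, a), map to the edge {a, b}; this absorbs the factor
    2. *)
Lemma edge_formE (R : realType) (G : sgraph) (x : G -> R) :
  edge_form x = \sum_i \sum_(j | adj i j) x i * x j.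
Proof.
rewrite /edge_form pair_big_dep /=.
rewrite (partition_big (fun u : G * G => [set u.1; u.2]%SET)
  (mem (edges G))) /=; last by move=> u uE; apply: imset_f; rewrite inE.
rewrite mulr_sumr; apply: eq_bigr => e /imsetP[[a b]]; rewrite inE /= => ab ->.
have nab : a != b by apply: contraTneq ab => ->; rewrite adj_irrefl.
rewrite big_setU1 ?inE //= big_set1.
rewrite (bigD1 (a, b)) /=; last by rewrite ab eqxx.
rewrite (bigD1 (b, a)) /=; last first.
  by rewrite adj_sym ab finset.setUC eqxx /= xpair_eqE eq_sym (negbTE nab).
rewrite big1 ?addr0; last first.
  move=> [c d] /= /andP[/andP[/andP[cd /eqP E]]]; rewrite !xpair_eqE.
  have: c \in [set a; b]%SET by rewrite -E !inE eqxx.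
  have: d \in [set a; b]%SET by rewrite -E !inE eqxx orbT.
  have: c != d by apply: contraTneq cd => ->; rewrite adj_irrefl.
  rewrite !inE => + dab cab; case/orP: dab => /eqP->; case/orP: cab => /eqP->;
    by rewrite ?eqxx ?andbF.
by rewrite [x b * _]mulrC -mulr2n mulr_natl.
Qed.


(** Away from 0 the power is differentiable. At 0 it is squeezed between 0 and [|t|], as p >= 1. *)
Lemma norm_powR_continuous (R : realType) (p : R) : 1 <= p ->
  continuous (fun t : R => `|t| `^ p).
Proof.
move=> p1 t; have [->|t0] := eqVneq t 0.
  rewrite /continuous_at normr0 powR0 ?gt_eqF ?(lt_le_trans ltr01)//.
  apply: (@squeeze_cvgr _ _ _ _ (cst 0) (fun t : R => `|t|)).
  - near=> s; rewrite powR_ge0 /=.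
    have s1 : `|s| <= 1 by near: s; apply: (@nbhs0_le R R^o); exact: ltr01.
    have [->|s0] := eqVneq s 0.
      by rewrite normr0 powR0 ?gt_eqF ?(lt_le_trans ltr01).
    by apply: ge1r_powR; rewrite // normr_gt0 s0.
  - exact: cvg_cst.
  - by rewrite -[X in (_ --> X)%classic](@normr0 R R); exact: norm_continuous.
apply: (@continuous_comp _ _ _ (fun t : R => `|t|) (fun s => s `^ p)).
  exact: norm_continuous.
apply/differentiable_continuous/derivable1_diffP.
by apply: derivable_powR; rewrite in_itv /= andbT normr_gt0.
Unshelve. all: by end_near. Qed.

Lemma sum_continuous (R : realType) (T : topologicalType) (I : Type)
    (s : seq I) (P : pred I) (F : I -> T -> R) :
  (forall i, continuous (F i)) ->
  continuous (fun x => \sum_(i <- s | P i) F i x).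
Proof.
move=> cF x; elim: s => [|i s IHs].
  by under eq_fun do rewrite big_nil; exact: cvg_cst.
under eq_fun do rewrite big_cons; case: (P i) => //.
exact: (cvgD (cF i x)).
Qed.

(** The sphere is a closed subset of the cube [-1, 1]^I, which is compact by Tychonoff. *)
Lemma pnorm_sphere_compact (R : realType) (p : R) (I : finType) : 1 <= p ->
  compact ([set x | \sum_i `|x i| `^ p = 1]%classic
     : set (prod_topology (fun _ : I => R))).
Proof.
move=> p1; have p0 : 0 < p by exact: lt_le_trans p1.
set K := [set x : prod_topology (fun _ : I => R) |
  forall i, `[-1, 1]%classic (x i)]%classic.
have cK : compact K.
  apply: (@tychonoff I (fun=> R) (fun=> `[-1, 1]%classic)) => _.
  exact: segment_compact.
apply: subclosed_compact cK _.
  have cN : continuous (fun x : prod_topology (fun _ : I => R) =>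
      \sum_i `|x i| `^ p).
    apply: sum_continuous => i x.
    apply: (@cvg_comp _ _ _ (fun x : prod_topology (fun _ : I => R) => x i)
      (fun t : R => `|t| `^ p)); last exact: norm_powR_continuous.
    exact: (@proj_continuous I (fun=> R) i x).
  have := @preimage_closed _ _ _ _ (in1W cN : {in _, _}) (@closed_eq R 1).
  by apply.
move=> x /= x1 i; rewrite /= in_itv /= -ler_norml leNgt; apply/negP => xi.
have: `|x i| `^ p <= 1.
  by rewrite -x1 (bigD1 i) //= lerDl sumr_ge0 // => j _; rewrite powR_ge0.
rewrite leNgt => /negP; apply; apply: (lt_le_trans xi).
by apply: le1r_powR => //; exact: ltW.
Qed.

(** The extreme value theorem gives a maximiser. Taking absolute values preserves the constraint and
    cannot decrease the form, so a nonnegative one exists. *)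
Lemma p_spectral_radius_max (R : realType) (p : R) (H : sgraph) :
  1 <= p -> (0 < #|H|)%N ->
  exists x : H -> R, [/\ forall i, 0 <= x i, \sum_i x i `^ p = 1,
    p_spectral_radius p H = edge_form x &
    forall z : H -> R, \sum_i `|z i| `^ p = 1 -> edge_form z <= edge_form x].
Proof.
move=> p1 H0; have p0 : 0 < p by exact: lt_le_trans p1.
set S := [set x : H -> R | \sum_(i : H) `|x i| `^ p = 1]%classic.
have [v _] : exists v, v \in [set: H]%SET by apply/card_gt0P; rewrite cardsT.
have S0 : (S !=set0)%classic.
  exists (fun i => (i == v)%:R); rewrite /S /= (bigD1 v) //= eqxx normr1 powR1.
  by rewrite big1 ?addr0 // => j /negbTE->; rewrite normr0 powR0 // gt_eqF.
have [x xS xmax] : exists2 x, x \in S & forall z, z \in S -> edge_form z <= edge_form x.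
  apply: (@compact_EVT_max (prod_topology (fun _ : H => R))) => //.
    exact: pnorm_sphere_compact.
  apply: continuous_subspaceT.
  rewrite (_ : edge_form (R:=R) (G:=H) =
    fun x : H -> R => \sum_i \sum_(j | adj i j) x i * x j); last first.
    by apply/funext => x; exact: edge_formE.
  apply: sum_continuous => i; apply: sum_continuous => j x.
  have cproj k : ((fun x : prod_topology (fun _ : H => R) => x k) @ x --> x k)%classic.
    exact: (@proj_continuous H (fun=> R) k x).
  exact: (cvgM (cproj i) (cproj j)).
have {}xmax z : S z -> edge_form z <= edge_form x.
  by move=> zS; apply: xmax; rewrite inE.
have axS : S (fun i => `|x i|).
  by move: xS; rewrite inE /S /=; under eq_bigr do rewrite -normr_id.
have axE : edge_form (fun i => `|x i|) = edge_form x.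
  apply/eqP; rewrite eq_le xmax //= !edge_formE; apply: ler_sum => i _.
  by apply: ler_sum => j _; rewrite -normrM ler_norm.
exists (fun i => `|x i|); rewrite axE; split => //; first by move: xS; rewrite inE.
rewrite /p_spectral_radius; apply/eqP; rewrite eq_le; apply/andP; split.
  by apply: ge_sup; [exact: image_nonempty|move=> _ [z zS <-]; exact: xmax].
apply: ub_le_sup; first by exists (edge_form x) => _ [z zS <-]; exact: xmax.
by exists (fun i => `|x i|).
Qed.

(** * Form and p-mass restricted to a vertex subset *)

(** Vectors live on all of [G] and only the set varies, so the same vector can be tested on [S] and
    on [S :\ u] without a change of type. *)
Definition qform (R : realType) (G : sgraph) (S : {set G}) (x : G -> R) : R :=
  \sum_(i in S) \sum_(j in S | adj i j) x i * x j.

Definition pmass (R : realType) (p : R) (G : sgraph) (S : {set G}) (x : G -> R) : R :=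
  \sum_(i in S) `|x i| `^ p.

Definition nbr_sum (R : realType) (G : sgraph) (S : {set G}) (x : G -> R) (v : G) : R :=
  \sum_(j in S | adj v j) x j.

Section Forms.
Variables (R : realType) (p : R) (G : sgraph).
Hypothesis p1 : 1 <= p.
Implicit Types (S : {set G}) (x y z : G -> R).

Let p0 : 0 < p. Proof. exact: lt_le_trans p1. Qed.

Lemma qformZ S c z : qform S (fun i => c * z i) = c ^+ 2 * qform S z.
Proof.
rewrite /qform mulr_sumr; apply: eq_bigr => i _; rewrite mulr_sumr.
by apply: eq_bigr => j _; rewrite mulrACA.
Qed.

Lemma pmassZ S c z : pmass p S (fun i => c * z i) = `|c| `^ p * pmass p S z.
Proof.
by rewrite /pmass mulr_sumr; apply: eq_bigr => i _; rewrite normrM powRM.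
Qed.

Lemma pmass_ge0 S z : 0 <= pmass p S z.
Proof. by apply: sumr_ge0 => i _; exact: powR_ge0. Qed.

Lemma edge_form_induced S y :
  edge_form (fun i : induced_sgraph S => y (val i)) = qform S y.
Proof.
rewrite edge_formE /qform [RHS]big_sub; apply: eq_bigr => i _.
by rewrite [RHS]big_sub_cond.
Qed.

Lemma pmass_induced S y :
  \sum_(i : induced_sgraph S) `|y (val i)| `^ p = pmass p S y.
Proof. by rewrite /pmass [RHS]big_sub. Qed.

Lemma card_induced S : #|induced_sgraph S| = #|S|.
Proof. by rewrite card_sig. Qed.

Lemma pmass_eq0 S z : pmass p S z = 0 -> {in S, forall i, z i = 0}.
Proof.
move=> /eqP; rewrite psumr_eq0 => [/allP z0 i iS|i _]; last exact: powR_ge0.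
have := z0 i (mem_index_enum i); rewrite iS /= powR_eq0 normr_eq0.
by case/andP=> /eqP.
Qed.

(** By homogeneity: scale [z] to mass 1. The scaling fails only at mass 0, where [z] vanishes on
    [S]. *)
Lemma qform_le_radius S z : (0 < #|S|)%N ->
  qform S z <= p_spectral_radius p (induced_sgraph S) * pmass p S z `^ (2 / p).
Proof.
rewrite -card_induced => S0.
have [x [_ _ -> xmax]] := p_spectral_radius_max p1 S0.
have [z0|z0] := eqVneq (pmass p S z) 0.
  rewrite z0 powR0 ?mulr0; last by rewrite mulf_neq0 ?invr_eq0 ?gt_eqF.
  rewrite /qform big1 // => i iS; rewrite big1 // => j _.
  by rewrite (pmass_eq0 z0 iS) mul0r.
have zgt0 : 0 < pmass p S z by rewrite lt0r z0 pmass_ge0.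
set c := pmass p S z `^ p^-1; have c0 : 0 < c by exact: powR_gt0.
have cp : c `^ p = pmass p S z.
  by rewrite -powRrM mulVf ?gt_eqF // powRr1 // ltW.
have c2 : c ^+ 2 = pmass p S z `^ (2 / p).
  by rewrite -powR_mulrn ?ltW // -powRrM mulrC.
have := xmax (fun i => c^-1 * z (val i)).
rewrite (edge_form_induced S (fun i => c^-1 * z i)).
rewrite (pmass_induced S (fun i => c^-1 * z i)) pmassZ qformZ.
have -> : `|c^-1| `^ p = (pmass p S z)^-1.
  by rewrite gtr0_norm ?invr_gt0 // -powR_inv1 ?ltW // powRAC cp powR_inv1 // ltW.
rewrite mulVf // => /(_ erefl).
by rewrite exprVn ler_pdivrMl ?exprn_gt0 // c2 mulrC.
Qed.

(** Extend an extremal vector of the induced subgraph by 0 and scale it by [#|S|] to the power 1/p,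
    so that the entries have p-th powers of mean 1. *)
Lemma qform_maximizer S : (0 < #|S|)%N ->
  exists y, [/\ forall i, 0 <= y i, pmass p S y = #|S|%:R &
    qform S y = p_spectral_radius p (induced_sgraph S) * #|S|%:R `^ (2 / p)].
Proof.
move=> S0; have N0 : 0 < #|S|%:R :> R by rewrite ltr0n.
have S0' : (0 < #|induced_sgraph S|)%N by rewrite card_induced.
have [x [x0 x1 -> _]] := p_spectral_radius_max p1 S0'.
set c := (#|S|%:R : R) `^ p^-1; have c0 : 0 < c by exact: powR_gt0.
have cp : c `^ p = #|S|%:R.
  by rewrite -powRrM mulVf ?gt_eqF // powRr1 // ltW.
have c2 : c ^+ 2 = #|S|%:R `^ (2 / p).
  by rewrite -powR_mulrn ?ltW // -powRrM mulrC.
pose y (i : G) := if insub i is Some u then x u else 0.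
have yx : (fun i : induced_sgraph S => y (val i)) = x.
  by apply/funext => i; rewrite /y valK.
exists (fun i => c * y i); split.
- by move=> i; rewrite mulr_ge0 ?(ltW c0) // /y; case: insub.
- rewrite pmassZ gtr0_norm // cp -pmass_induced.
  under eq_bigr => i _ do rewrite /y valK ger0_norm //.
  by rewrite x1 mulr1.
- by rewrite qformZ -edge_form_induced yx c2 mulrC.
Qed.

(** Young's inequality for the product t * 1. At p = 1 the conjugate exponent is infinite, so that
    case is separate. *)
Lemma le_powR_young (t : R) : 0 <= t -> t <= t `^ p / p + (1 - p^-1).
Proof.
move=> t0; have [pe|pn] := eqVneq p 1.
  by rewrite pe powRr1 // invr1 mulr1 subrr addr0.
have p1' : 1 < p by rewrite lt_neqAle eq_sym pn.
have q0 : 0 < 1 - p^-1 by rewrite subr_gt0 invf_lt1.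
have := @conjugate_powR R t 1 p (1 - p^-1)^-1 t0 ler01 p0.
rewrite invr_gt0 q0 invrK addrC subrK => /(_ isT erefl).
by rewrite mulr1 powR1 mul1r.
Qed.

(** The form is at most the square of the sum of the absolute values, and Young's inequality
    termwise bounds that sum by [#|S|]. *)
Lemma qform_le_sqr_card S z : pmass p S z = #|S|%:R -> qform S z <= #|S|%:R ^+ 2.
Proof.
move=> zN; set Z := \sum_(i in S) `|z i|.
have ZN : Z <= #|S|%:R.
  have -> : #|S|%:R = \sum_(i in S) (`|z i| `^ p / p + (1 - p^-1)).
    rewrite big_split /= -mulr_suml -/(pmass p S z) zN sumr_const.
    rewrite -[X in _ + X]mulr_natr.
    ring.
  by apply: ler_sum => i _; exact: le_powR_young.
apply: (@le_trans _ _ (Z ^+ 2)); last first.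
  by rewrite lerXn2r ?nnegrE ?ler0n // sumr_ge0.
rewrite expr2 {1}/Z mulr_suml; apply: ler_sum => i _.
rewrite mulr_sumr big_mkcondr /=; apply: ler_sum => j _.
case: ifP => _; last by rewrite mulr_ge0.
by rewrite -normrM ler_norm.
Qed.

End Forms.

(** * Vertex deletion identities and the eigenvalue equation *)

Section Eigen.
Variables (R : realType) (p : R) (G : sgraph).
Hypothesis p1 : 1 <= p.
Implicit Types (S : {set G}) (x y z : G -> R).

Let p0 : 0 < p. Proof. exact: lt_le_trans p1. Qed.

Lemma qform_setD1 S x v : v \in S ->
  qform S x = 2 * x v * nbr_sum S x v + qform (S :\ v) x.
Proof.
move=> vS; rewrite /qform (big_setD1 v) //= -mulr_sumr -/(nbr_sum S x v).
have -> : \sum_(i in S :\ v) \sum_(j in S | adj i j) x i * x j =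
  \sum_(i in S :\ v) ((if adj v i then x v * x i else 0) +
    \sum_(j in S :\ v | adj i j) x i * x j).
  apply: eq_bigr => i iS; rewrite big_mkcondr (big_setD1 v) //= -big_mkcondr.
  by rewrite adj_sym [x i * x v]mulrC.
rewrite big_split /= -big_mkcondr /= -mulr_sumr addrA -mulrA mulr_natl mulr2n.
congr (_ + _ * _ + _); rewrite /nbr_sum [RHS]big_mkcondr (big_setD1 v) //=.
by rewrite adj_irrefl add0r -big_mkcondr.
Qed.

Lemma pmass_setD1 S x v : v \in S ->
  pmass p S x = `|x v| `^ p + pmass p (S :\ v) x.
Proof. by move=> vS; rewrite /pmass (big_setD1 v). Qed.

(** Instead of Lagrange multipliers, only coordinate [v] varies. The gap [g] between the radius
    bound and the form is nonnegative for t > 0 and zero at [y v], so its derivative vanishes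
    there. *)
Lemma nbr_sum_maximizer S y v : v \in S -> (forall i, 0 <= y i) ->
  0 < y v -> pmass p S y = #|S|%:R ->
  qform S y = p_spectral_radius p (induced_sgraph S) * #|S|%:R `^ (2 / p) ->
  nbr_sum S y v * #|S|%:R = qform S y * y v `^ (p - 1).
Proof.
move=> vS y0 yv0 yN yq.
have S0 : (0 < #|S|)%N by apply/card_gt0P; exists v.
set l := p_spectral_radius _ _ in yq; set N := #|S|%:R in yN yq *.
have N0 : 0 < N by rewrite ltr0n.
set C := qform (S :\ v) y; set B := nbr_sum S y v.
set D := pmass p (S :\ v) y.
pose h (t : R) := D + t `^ p.
pose g (t : R) := l * (h t) `^ (2 / p) - (2 * B * t + C).
have D0 : 0 <= D by exact: pmass_ge0.
have hN : h (y v) = N by rewrite /h -yN (pmass_setD1 _ vS) ger0_norm // addrC.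
have h0 (t : R) : 0 < t -> 0 < h t by move=> t0; rewrite ltr_wpDl // powR_gt0.
have g0 : g (y v) = 0.
  by rewrite /g hN -yq (qform_setD1 _ vS) -/B -/C; ring.
have gge0 (t : R) : 0 < t -> 0 <= g t.
  move=> t0; pose z i := if i == v then t else y i.
  have zC : qform (S :\ v) z = C.
    apply: eq_bigr => i; rewrite !inE => /andP[iv _].
    apply: eq_bigr => j; rewrite !inE => /andP[/andP[jv _] _].
    by rewrite /z (negbTE iv) (negbTE jv).
  have zB : nbr_sum S z v = B.
    apply: eq_bigr => j /andP[_ vj]; rewrite /z ifN //.
    by apply: contraTneq vj => ->; rewrite adj_irrefl.
  have zD : pmass p (S :\ v) z = D.
    by apply: eq_bigr => i; rewrite !inE => /andP[iv _]; rewrite /z (negbTE iv).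
  have zv : z v = t by rewrite /z eqxx.
  have := qform_le_radius p1 z S0.
  rewrite (qform_setD1 _ vS) (pmass_setD1 _ vS) zC zB zD zv (gtr0_norm t0).
  rewrite -/l /g /h [_ + D]addrC subr_ge0; congr (_ <= _); ring.
have dg (t : R) : 0 < t -> is_derive t (1 : R) g
    (l * (2 / p * h t `^ (2 / p - 1) * (p * t `^ (p - 1))) - 2 * B).
  move=> t0.
  have dh : is_derive t (1 : R) h (0 + p * t `^ (p - 1)).
    exact: (is_deriveD (is_derive_cst D t 1) (is_derive1_powR p t0)).
  have dhp := is_derive1_comp (is_derive1_powR (2 / p) (h0 t t0)) dh.
  have dg := is_deriveB (is_deriveZ l dhp)
    (is_deriveD (is_deriveZ (2 * B) (is_derive_id t 1)) (is_derive_cst C t 1)).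
  apply: (is_derive_eq dg).
  by rewrite /GRing.scale /= mulr1 addr0 add0r.
have : is_derive (y v) (1 : R) g 0.
  (* The interval from 0 to [2 * y v] surrounds [y v] and stays where the powers are
     differentiable. *)
  apply: (@derive1_at_min _ _ 0 (2 * y v)).
  - by rewrite mulr_ge0 // ltW.
  - by move=> t; rewrite in_itv /= => /andP[t0 _]; have [] := dg t t0.
  - by rewrite in_itv /= yv0 /= ltr_pMl // ltr1n.
  - by move=> t; rewrite in_itv /= => /andP[t0 _]; rewrite g0 gge0.
move=> d0; have [_ e1] := dg _ yv0; have [_ e2] := d0.
move: e1; rewrite e2 hN yq => e1.
have -> : N `^ (2 / p) = N * N `^ (2 / p - 1).
  by rewrite mulr_powRB1 ?ltW // divr_gt0.
have : 2 * B = 2 * l * N `^ (2 / p - 1) * y v `^ (p - 1).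
  apply/eqP; rewrite -subr_eq0; apply/eqP; rewrite -[RHS]oppr0 [in RHS]e1.
  by field; rewrite gt_eqF.
move=> /(congr1 (fun s => s / 2 * N)) e3.
transitivity (2 * B / 2 * N); first by field.
by rewrite e3; field.
Qed.

End Eigen.

(** * The numerical inequality for one deletion *)

(* On the logarithmic scale, in units of theta / N, the gain is at least
   2 (1 - sigma) / gamma >= 1.58, while the losses are 1 + 1/4 up to lower order
   and at most 4/15 from the discarded term sigma^2 = (N - sigma)^2 - N (N - 2 sigma). *)
Lemma removal_gain (R : realType) (p gamma theta N sigma : R) :
  1 < p -> p <= 2 -> 0 < gamma -> 4 * gamma <= 1 -> theta = gamma * (p - 1) / p ->
  4 <= N * theta -> 0 < N -> 0 <= sigma -> sigma <= 1 - 79 / 100 * gamma ->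
  N `^ theta * (1 + theta / (4 * N)) *
    ((N - 1) ^+ 2 * ((N - sigma) / (N - 1)) `^ (2 / p)) <=
  (N - 1) `^ theta * (N * (N - 2 * sigma)).
Proof.
move=> p1 p2 g0 g4 tE Nt N0 s0 s1.
have p0 : 0 < p by lra.
have t0 : 0 < theta by rewrite tE divr_gt0 // mulr_gt0 //; lra.
have tg : 2 * theta <= gamma.
  rewrite tE mulrA ler_pdivrMr //; nra.
set beta := 2 - 2 / p.
have bg : beta * gamma = 2 * theta by rewrite tE /beta; field; rewrite gt_eqF.
have b0 : 0 <= beta by rewrite -(pmulr_lge0 _ g0) bg; lra.
have N32 : 32 <= N by nra.
set M := N - 1; have M0 : 0 < M by rewrite /M; lra.
have NE : N = M + 1 by rewrite /M; lra.
have sN : 0 < N - sigma by lra.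
(* Chosen so that 1 / (1 + w) = 1 - 1 / M^2. *)
set w := (M ^+ 2 - 1)^-1.
have M1 : 0 < M ^+ 2 - 1 by rewrite /M; nra.
have hw : expR (- w) <= 1 - (M ^+ 2)^-1.
  have : 1 + w <= expR w by exact: expR_ge1Dx.
  rewrite expRN => hw; apply: (@le_trans _ _ (1 + w)^-1).
    by rewrite lef_pV2 ?posrE ?expR_gt0 // addr_gt0 // invr_gt0.
  rewrite le_eqVlt; apply/orP; left; apply/eqP; rewrite /w; field.
  by rewrite !gt_eqF //=; lra.
have hY : (N / M) `^ theta <= expR (theta / M).
  rewrite [theta / M]mulrC expRM; apply: ge0_ler_powR.
  - exact: ltW.
  - by rewrite nnegrE divr_ge0 // ltW.
  - by rewrite nnegrE expR_ge0.
  - by rewrite (_ : N / M = 1 + M^-1) ?expR_ge1Dx // NE mulrDl divff ?mul1r ?gt_eqF.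
have hX : (M / (N - sigma)) `^ beta <= expR (- ((1 - sigma) / N * beta)).
  rewrite -mulNr expRM; apply: ge0_ler_powR => //.
  - by rewrite nnegrE divr_ge0 // ltW.
  - by rewrite nnegrE expR_ge0.
  - apply: le_trans (expR_ge1Dx _); rewrite ler_pdivrMr //.
    have : 0 <= (1 - sigma) / N by rewrite divr_ge0 ?(ltW N0) //; lra.
    have : (1 - sigma) / N * N = 1 - sigma by rewrite divfK // gt_eqF.
    rewrite /M; nra.
have hZ : 1 + theta / (4 * N) <= expR (theta / (4 * N)) by exact: expR_ge1Dx.
have hE : theta / M + theta / (4 * N) - (1 - sigma) / N * beta <= - w.
  set q := theta / N.
  have q0 : 0 < q by rewrite divr_gt0.
  have e1 : theta / (4 * N) = q / 4 by rewrite /q; field; rewrite gt_eqF.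
  have e2 : theta / M <= 32 / 31 * q.
    rewrite ler_pdivrMr // (_ : 32 / 31 * q * M = 32 / 31 * theta * M / N).
      by rewrite ler_pdivlMr // /M; nra.
    by rewrite /q; ring.
  have e3 : 158 / 100 * q <= (1 - sigma) / N * beta.
    rewrite [leRHS]mulrAC [leLHS]mulrA ler_pM2r ?invr_gt0 //; nra.
  (* Here M^2 - 1 = N (N - 2), and theta (N - 2) >= 4 - 1/4 = 15/4. *)
  have e4 : w <= 4 / 15 * q.
    rewrite /w -div1r ler_pdivrMr //.
    rewrite (_ : 4 / 15 * q * (M ^+ 2 - 1) = 4 / 15 * theta * (N - 2)).
      by nra.
    by rewrite /q /M; field; rewrite gt_eqF.
  lra.
have NM : N `^ theta = M `^ theta * (N / M) `^ theta.
  by rewrite -powRM ?divr_ge0 ?ltW // mulrCA divff ?mulr1 // gt_eqF.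
have XE : M ^+ 2 * ((N - sigma) / M) `^ (2 / p) =
    (N - sigma) ^+ 2 * (M / (N - sigma)) `^ beta.
  have c0 : 0 < (N - sigma) / M by exact: divr_gt0.
  have cV : (M / (N - sigma)) `^ (2 / p) = (((N - sigma) / M) `^ (2 / p))^-1.
    by rewrite -[M / _]invf_div -(powR_inv1 (ltW c0)) -powRrM mulN1r powRN.
  rewrite /beta powRB; last by apply/implyP => _; rewrite gt_eqF // divr_gt0.
  rewrite powR_mulrn ?divr_ge0 ?(ltW M0) ?(ltW sN) // cV invrK expr_div_n.
  by field; rewrite gt_eqF.
rewrite NM XE [leLHS](_ : _ = M `^ theta * ((N / M) `^ theta *
  (1 + theta / (4 * N)) * (M / (N - sigma)) `^ beta * (N - sigma) ^+ 2)); last by ring.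
rewrite ler_pM2l ?powR_gt0 //.
apply: (@le_trans _ _ ((1 - (M ^+ 2)^-1) * (N - sigma) ^+ 2)).
  rewrite ler_wpM2r ?sqr_ge0 //; apply: le_trans hw.
  apply: le_trans (_ : expR (theta / M + theta / (4 * N) - (1 - sigma) / N * beta) <= _);
    last by rewrite ler_expR.
  rewrite !expRD; apply: ler_pM => //; rewrite ?powR_ge0 //.
    by rewrite mulr_ge0 ?powR_ge0 // addr_ge0 // divr_ge0 ?mulr_ge0 // ltW.
  by apply: ler_pM; rewrite ?powR_ge0 // addr_ge0 // divr_ge0 ?mulr_ge0 // ltW.
(* As sigma <= 1, sigma (N - 1) <= N - sigma. Hence sigma^2 costs at most the fraction 1 / M^2 of (N
   - sigma)^2. *)
have sM : sigma ^+ 2 * M ^+ 2 <= (N - sigma) ^+ 2.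
  rewrite -exprMn lerXn2r ?nnegrE ?mulr_ge0 ?(ltW M0) ?(ltW sN) //; rewrite /M; nra.
have : sigma ^+ 2 <= (M ^+ 2)^-1 * (N - sigma) ^+ 2.
  by rewrite mulrC ler_pdivlMr // exprn_gt0.
nra.
Qed.

(** * The normalised radius under deletion of a vertex *)

Definition nbrs (G : sgraph) (S : {set G}) (v : G) : {set G} :=
  [set w in S | adj v w]%SET.

(* The normalisation lambda * N^(2/p - 2), for which the wanted bound on lambda
   reads A < density. *)
Definition density (R : realType) (p : R) (G : sgraph) (S : {set G}) : R :=
  p_spectral_radius p (induced_sgraph S) * #|S|%:R `^ (2 / p) / #|S|%:R ^+ 2.

Section Step.
Variables (R : realType) (p : R) (G : sgraph).
Hypothesis p1 : 1 < p.
Implicit Types (S : {set G}) (x y z : G -> R).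

Let p0 : 0 < p. Proof. exact: lt_trans p1. Qed.

Lemma density_maximizer S : (0 < #|S|)%N ->
  exists y, [/\ forall i, 0 <= y i, pmass p S y = #|S|%:R,
    qform S y = density p S * #|S|%:R ^+ 2 &
    {in S, forall v, nbr_sum S y v * y v = density p S * #|S|%:R * y v `^ p /\
      density p S * #|S|%:R * y v `^ (p - 1) <= nbr_sum S y v}].
Proof.
move=> S0; have N0 : 0 < #|S|%:R :> R by rewrite ltr0n.
have [y [y0 yN yq]] := qform_maximizer (ltW p1) S0.
have qd : qform S y = density p S * #|S|%:R ^+ 2.
  by rewrite yq /density divfK // gt_eqF // exprn_gt0.
exists y; split => // v vS.
have [yv|yv] := eqVneq (y v) 0.
  rewrite yv powR0 ?gt_eqF // powR0 ?subr_eq0 ?gt_eqF // !mulr0; split => //.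
  by apply: sumr_ge0 => j _; exact: y0.
have yv0 : 0 < y v by rewrite lt0r yv y0.
have e : nbr_sum S y v = density p S * #|S|%:R * y v `^ (p - 1).
  have := nbr_sum_maximizer (ltW p1) vS y0 yv0 yN yq.
  rewrite qd => h; apply: (mulIf (lt0r_neq0 N0)); rewrite h; ring.
by rewrite e; split => //; rewrite -mulrA [_ * y v]mulrC mulr_powRB1 // ltW.
Qed.

Lemma density_le1 S : (0 < #|S|)%N -> density p S <= 1.
Proof.
move=> S0; have [y [_ yN yq _]] := density_maximizer S0.
have := qform_le_sqr_card (ltW p1) yN; rewrite yq -[leRHS]mul1r ler_pM2r //.
by rewrite exprn_gt0 // ltr0n.
Qed.

(** With d neighbours of p-mass T, Young's inequality gives the bound T/p + d (1 - 1/p). Both T and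
    d are at most N - (N - d) s: each of the N - d other vertices carries mass at least s, and s <=
    1. *)
Lemma nbr_sum_le S y v s : v \in S -> (forall i, 0 <= y i) ->
  pmass p S y = #|S|%:R -> s <= 1 -> {in S, forall i, s <= y i `^ p} ->
  nbr_sum S y v <= #|S|%:R - (#|S|%:R - #|nbrs S v|%:R) * s.
Proof.
move=> vS y0 yN s1 sy; set N := #|S|%:R in yN *; set d := #|nbrs S v|%:R.
have p1' : 0 <= p^-1 <= 1 by rewrite invr_ge0 ltW //= invf_le1 // ltW.
have dE c : \sum_(j in S | adj v j) c = d * c :> R.
  rewrite (eq_bigl (mem (nbrs S v))); last by move=> j; rewrite !inE.
  by rewrite sumr_const -mulr_natl.
have split (F : G -> R) : \sum_(j in S) F j =
    \sum_(j in S | adj v j) F j + \sum_(j in S | ~~ adj v j) F j.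
  by rewrite (bigID (adj v)).
have ndE : \sum_(j in S | ~~ adj v j) s = (N - d) * s.
  have := split (fun=> s); rewrite dE sumr_const -mulr_natl -/N => h; lra.
have dN : d <= N.
  rewrite ler_nat subset_leq_card //; apply/fintype.subsetP => j.
  by rewrite inE => /andP[].
have T : \sum_(j in S | adj v j) y j `^ p <= N - (N - d) * s.
  have e : pmass p S y = _ := split (fun j => `|y j| `^ p).
  have e1 : \sum_(j in S | adj v j) y j `^ p = \sum_(j in S | adj v j) `|y j| `^ p.
    by apply: eq_bigr => j _; rewrite ger0_norm.
  have : \sum_(j in S | ~~ adj v j) s <= \sum_(j in S | ~~ adj v j) `|y j| `^ p.
    by apply: ler_sum => j /andP[jS _]; rewrite ger0_norm // sy.
  rewrite ndE; lra.
apply: (@le_trans _ _ (\sum_(j in S | adj v j) (y j `^ p / p + (1 - p^-1)))).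
  by apply: ler_sum => j _; apply: le_powR_young => //; exact: ltW.
rewrite big_split /= -mulr_suml dE.
have dX : d <= N - (N - d) * s.
  by have := ler_wpM2l (_ : 0 <= N - d) s1; rewrite subr_ge0 mulr1 => /(_ dN); lra.
move: T dX; set t := \sum_(j in _ | _) _; set X := N - _ => T dX.
case/andP: p1' => i0 i1.
have := ler_wpM2r i0 T; have := ler_wpM2r (_ : 0 <= 1 - p^-1) dX.
rewrite subr_ge0 i1 => /(_ isT); lra.
Qed.

(** The low-degree vertex [v] serves to bound the smallest entry; the vertex removed is the [u] that
    attains it. The slack gamma / 100 admits the initial graph, whose density may lie below A. *)
Lemma density_setD1 (gamma theta A : R) S v : v \in S ->
  p <= 2 -> 0 < gamma -> 4 * gamma <= 1 -> theta = gamma * (p - 1) / p ->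
  4 <= #|S|%:R * theta -> 0 <= A - gamma -> A - gamma / 100 <= density p S ->
  #|nbrs S v|%:R <= (A - gamma) * #|S|%:R ->
  exists2 u, u \in S &
    density p S * (#|S|%:R `^ theta * (1 + theta / (4 * #|S|%:R))) <=
    density p (S :\ u) * (#|S|%:R - 1) `^ theta.
Proof.
move=> vS p2 g0 g4 tE Nt Ag aA dv.
have S0 : (0 < #|S|)%N by apply/card_gt0P; exists v.
have [y [y0 yN yq yeig]] := density_maximizer S0.
case: (arg_minP y vS) => u; rewrite -/(u \in S) => uS umin; exists u => //.
have N0 : 0 < #|S|%:R :> R by rewrite ltr0n.
set a := density p S in yq yeig aA *; set N : R := #|S|%:R in yN yq yeig Nt N0 dv *.
set sigma := y u `^ p.
have s0 : 0 <= sigma by exact: powR_ge0.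
have smin i : i \in S -> sigma <= y i `^ p.
  by move=> iS; apply: ge0_ler_powR; rewrite ?nnegrE ?(ltW p0) ?umin.
(* The p-th powers of the entries have mean 1. *)
have s1 : sigma <= 1.
  rewrite -(ler_pM2l N0) mulr1 -[leRHS]yN /pmass mulr_natl -sumr_const.
  by apply: ler_sum => i iS; rewrite ger0_norm // smin.
have yu1 : y u <= 1.
  rewrite leNgt; apply/negP => yu1; move: s1; rewrite leNgt; case/negP.
  by apply: (lt_le_trans yu1); exact: (le1r_powR (ltW yu1) (ltW p1)).
have a0 : 0 <= a by lra.
(* The eigenvalue inequality at [v] yields (1 + 99/100 gamma) sigma <= 1. The constant 79/100 comes
   from 0.99 / (1 + 0.99/4) > 0.79, with gamma <= 1/4. *)
have sb : sigma <= 1 - 79 / 100 * gamma.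
  have B := nbr_sum_le vS y0 yN s1 smin; rewrite -/N in B.
  have [_ vE] := yeig _ vS.
  have h : a * N * sigma <= a * N * y v `^ (p - 1).
    apply: ler_wpM2l; first by rewrite mulr_ge0 // ltW.
    apply: (@le_trans _ _ (y u `^ (p - 1))); last first.
      by apply: ge0_ler_powR; rewrite ?nnegrE ?subr_ge0 ?(ltW p1) ?umin.
    rewrite /sigma -[y u `^ p](mulr_powRB1 (y0 u) p0).
    by rewrite ler_piMl ?powR_ge0.
  have : a * N * sigma <= N - (N - (A - gamma) * N) * sigma.
    apply: le_trans h _; apply: le_trans vE _; apply: le_trans B _.
    by have := ler_wpM2r s0 dv; lra.
  move=> aN; have as1 : a * sigma <= 1 - (1 - (A - gamma)) * sigma.
    by rewrite -(ler_pM2l N0); lra.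
  have : (1 + 99 / 100 * gamma) * sigma <= 1.
    by have := ler_wpM2r s0 aA; lra.
  nra.
have S1 : #|S :\ u|%:R = N - 1 :> R.
  by rewrite /N (cardsD1 u S) uS natrD [X in _ = X]addrC addKr.
have N4 : 4 <= N.
  have t1 : theta <= 1.
    have : 0 <= (1 - 4 * gamma) * (p - 1) by rewrite mulr_ge0 // subr_ge0 // ltW.
    by rewrite tE ler_pdivrMr //; have := p0; lra.
  by apply: le_trans Nt _; rewrite ler_piMr // ltW.
have M0 : 0 < N - 1 by lra.
have S'0 : (0 < #|S :\ u|)%N by rewrite -(ltr_nat R) S1.
have qE : qform (S :\ u) y = a * (N * (N - 2 * sigma)).
  have := qform_setD1 y uS; rewrite yq; have [uE _] := yeig _ uS.
  rewrite -mulrA [y u * _]mulrC uE -/sigma; lra.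
have mE : pmass p (S :\ u) y = N - sigma.
  by have := pmass_setD1 p y uS; rewrite yN ger0_norm // -/sigma => ->; ring.
have sN : 0 < N - sigma by lra.
(* The old maximiser is the test vector for the smaller set. *)
have := qform_le_radius (ltW p1) y S'0; rewrite qE mE.
have -> : p_spectral_radius p (induced_sgraph (S :\ u)) * (N - sigma) `^ (2 / p) =
    density p (S :\ u) * ((N - 1) ^+ 2 * ((N - sigma) / (N - 1)) `^ (2 / p)).
  have e : (N - sigma) `^ (2 / p) =
      (N - 1) `^ (2 / p) * ((N - sigma) / (N - 1)) `^ (2 / p).
    by rewrite -powRM ?divr_ge0 ?(ltW M0) ?(ltW sN) // mulrCA divff ?mulr1 // gt_eqF.
  by rewrite /density S1 e; field; rewrite gt_eqF.
set W := _ ^+ 2 * _ => h.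
have W0 : 0 < W by rewrite mulr_gt0 ?exprn_gt0 ?powR_gt0 ?divr_gt0.
rewrite -(ler_pM2r W0) -mulrA.
have K := removal_gain p1 p2 g0 g4 tE Nt N0 s0 sb.
apply: le_trans (ler_wpM2l a0 K) _.
rewrite mulrCA [leRHS](_ : _ = (N - 1) `^ theta * (density p (S :\ u) * W));
  last by ring.
by rewrite ler_wpM2l ?powR_ge0.
Qed.

End Step.

(** * Minimum degrees and iterated deletion *)

Lemma exists_degree_le_min_degree (G : sgraph) : (0 < #|G|)%N ->
  exists v : G, (degree v <= min_degree G)%N.
Proof.
move=> /card_gt0P[v0 _]; rewrite /min_degree.
elim/big_rec: _ => [|v x _ [w wx]].
  by exists v0; rewrite /degree max_card.
by have [vx|xv] := leqP (degree v) x; [exists v|exists w].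
Qed.

Lemma degree_induced (G : sgraph) (S : {set G}) (v : induced_sgraph S) :
  degree v = #|nbrs S (val v)|.
Proof.
rewrite /degree -!sum1_card.
rewrite (eq_bigl (fun w : induced_sgraph S => adj (val v) (val w))); last first.
  by move=> w; rewrite inE.
rewrite [RHS](eq_bigl (fun w => (w \in S) && adj (val v) w)); last first.
  by move=> w; rewrite inE.
by rewrite [RHS]big_sub_cond.
Qed.

(** The subgraph induced on the full set has another vertex type, so an extremal vector of [G] is
    carried over as a test vector. *)
Lemma density_setT (R : realType) (p : R) (G : sgraph) : 1 <= p -> (0 < #|G|)%N ->
  p_spectral_radius p G * #|G|%:R `^ (2 / p) / #|G|%:R ^+ 2 <= density p [set: G].
Proof.
move=> p1 G0; have [x [x0 x1 -> _]] := p_spectral_radius_max p1 G0.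
have T0 : (0 < #|[set: G]%SET|)%N by rewrite cardsT.
rewrite /density cardsT ler_wpM2r ?invr_ge0 ?exprn_ge0 // ler_wpM2r ?powR_ge0 //.
have := qform_le_radius p1 x T0.
have -> : pmass p [set: G] x = 1.
  by rewrite -x1 /pmass; apply: eq_big => [i|i _]; rewrite ?inE // ger0_norm.
rewrite powR1 mulr1 edge_formE /qform; congr (_ <= _).
apply: eq_big => [i|i _]; first by rewrite inE.
by apply: eq_bigl => j; rewrite inE.
Qed.

(** Induction on [#|S|] with [n] fixed: the potential density * [#|S|]^theta stays above A n^theta.
    Density at most 1 then keeps [#|S|] large, and [#|S|] <= n keeps the density above A. *)
Lemma dense_subgraph (R : realType) (p gamma A theta : R) (n : nat) (G : sgraph)
    (S : {set G}) :
  1 < p -> p <= 2 -> 0 < gamma -> 4 * gamma < A -> A < 1 ->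
  theta = gamma * (p - 1) / p -> 4 <= A `^ theta^-1 * n%:R * theta ->
  (#|S| <= n)%N -> A * n%:R `^ theta < density p S * #|S|%:R `^ theta ->
  exists S' : {set G}, [/\ A `^ theta^-1 * n%:R < #|S'|%:R,
    A < density p S' &
    (A - gamma) * #|S'|%:R < (min_degree (induced_sgraph S'))%:R].
Proof.
move=> p1 p2 g0 gA A1 tE nt; have p0 : 0 < p by lra.
have t0 : 0 < theta by rewrite tE divr_gt0 // mulr_gt0 //; lra.
have A0 : 0 < A by lra.
move mE : #|S| => m; elim: m S mE => [|m IHm] S mE mn HS.
  have := mulr_ge0 (ltW A0) (powR_ge0 n%:R theta).
  by move: HS; rewrite powR0 ?gt_eqF // mulr0; lra.
have S0 : (0 < #|S|)%N by rewrite mE.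
have N0 : 0 < m.+1%:R :> R by rewrite ltr0n.
have d1 := density_le1 p1 S0.
have AN : A `^ theta^-1 * n%:R < m.+1%:R.
  have h : A * n%:R `^ theta < m.+1%:R `^ theta.
    by apply: lt_le_trans HS _; rewrite ler_piMl ?powR_ge0.
  have := gt0_ltr_powR (_ : 0 < theta^-1) (_ : _ \in Num.nneg) (_ : _ \in Num.nneg) h.
  rewrite invr_gt0 !nnegrE ?powR_ge0 ?mulr_ge0 ?powR_ge0 ?(ltW A0) //.
  move=> /(_ t0 isT isT).
  by rewrite powRM ?powR_ge0 ?(ltW A0) // -!powRrM mulfV ?gt_eqF // !powRr1.
have dA : A < density p S.
  have n0 : 0 < n%:R `^ theta :> R by rewrite powR_gt0 // ltr0n (leq_trans _ mn).
  have Nt : 0 < m.+1%:R `^ theta :> R by exact: powR_gt0.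
  have d0 : 0 < density p S.
    by rewrite -(pmulr_lgt0 _ Nt); apply: le_lt_trans HS; rewrite mulr_ge0 // ltW.
  rewrite -(ltr_pM2r n0); apply: lt_le_trans HS _; apply: ler_wpM2l.
    exact: ltW.
  by apply: ge0_ler_powR; rewrite ?nnegrE ?ler_nat // ltW.
have [dS|dS] := ltP ((A - gamma) * #|S|%:R) (min_degree (induced_sgraph S))%:R.
  by exists S; rewrite mE; split => //; rewrite -mE.
have [w wS] : exists v : induced_sgraph S,
    (degree v <= min_degree (induced_sgraph S))%N.
  by apply: exists_degree_le_min_degree; rewrite card_induced.
have vS := valP w; rewrite degree_induced in wS.
have vd : #|nbrs S (val w)|%:R <= (A - gamma) * #|S|%:R.
  by apply: le_trans dS; rewrite ler_nat.
have [||||u uS] := density_setD1 p1 vS p2 g0 _ tE _ _ _ vd.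
- lra.
(* The lower bound on the order gives N theta >= 4 at every stage. *)
- by rewrite mE; apply: le_trans nt _; rewrite ler_pM2r // ltW.
- lra.
- lra.
rewrite mE => hu; have mS : #|S :\ u| = m.
  by move: mE; rewrite (cardsD1 u S) uS => -[].
apply: (IHm (S :\ u)) => //; first exact: ltnW.
(* The gain factor 1 + theta / (4 N) is at least 1 and is dropped here. *)
apply: lt_le_trans HS _; rewrite -natr1 addrK in hu.
apply: le_trans hu; rewrite natr1 ler_wpM2l //; first by apply: ltW; lra.
by rewrite ler_peMr ?powR_ge0 // lerDl divr_ge0 ?mulr_ge0 // ltW.
Qed.

(** * The first deletion and the conclusion *)

Theorem theorem7 (R : realType) (p gamma A r : R) (n : nat)
  (hp1 : 1 < p) (hp2 : p <= 2)
  (hgamma : 0 < 4 * gamma) (hgammaA : 4 * gamma < A) (hA : A < 1)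
  (hr : 0 <= r)
  (hn : n%:R > 4 * (r + 1) * p / (gamma * (p - 1))
               * A `^ (- p / (gamma * p - gamma)))
  (G : sgraph) (hG : #|G| = n)
  (hlambda : p_spectral_radius p G * n%:R `^ (2 / p - 1)
             >= A * n%:R - r / n%:R)
  (hdelta : (min_degree G)%:R <= (A - gamma) * n%:R) :
  exists (S : {set G}) (k : nat),
    let H := induced_sgraph S in
    [/\ #|H| = k,
        k%:R > A `^ (p / (gamma * p - gamma)) * n%:R,
        p_spectral_radius p H * k%:R `^ (2 / p - 1) > A * k%:R &
        (min_degree H)%:R > (A - gamma) * k%:R].
Proof.
have g0 : 0 < gamma by lra.
have p0 : 0 < p by lra.
have A0 : 0 < A by lra.
have pm0 : 0 < p - 1 by lra.
have gp0 : 0 < gamma * (p - 1) by exact: mulr_gt0.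
set theta := gamma * (p - 1) / p.
have t0 : 0 < theta by exact: divr_gt0.
have t1 : theta < 1.
  have : 0 <= (1 - 4 * gamma) * (p - 1) by rewrite mulr_ge0; lra.
  by rewrite ltr_pdivrMr //; lra.
have eT : p / (gamma * p - gamma) = theta^-1.
  by rewrite /theta invf_div; congr (_ / _); ring.
have hA1 : 0 < A `^ theta^-1 by exact: powR_gt0.
(* The assumed lower bound on [n], rewritten with theta. *)
have hn' : 4 * (r + 1) < A `^ theta^-1 * n%:R * theta.
  have e : 4 * (r + 1) * p / (gamma * (p - 1)) = 4 * (r + 1) / theta.
    by rewrite /theta; field; rewrite !gt_eqF.
  move: hn; rewrite e mulNr eT powRN ltr_pdivrMr // ltr_pdivrMr //.
  by rewrite [n%:R * _]mulrC.
have hAle : A `^ theta^-1 <= A.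
  by rewrite ge1r_powR ?A0 ?(ltW hA) // invf_ge1 // ltW.
have n0 : 0 < n%:R :> R.
  have : 0 < A `^ theta^-1 * n%:R * theta by lra.
  by rewrite pmulr_lgt0 // pmulr_rgt0.
have Ant : 4 * (r + 1) < A * n%:R * theta.
  apply: lt_le_trans hn' _; rewrite ler_pM2r // ler_pM2r //.
have nt : 4 * (r + 1) < n%:R * theta.
  apply: lt_le_trans Ant _; rewrite ler_pM2r // ler_piMl //; exact: ltW.
have G0 : (0 < #|G|)%N by rewrite hG -(ltr0n R).
have pows k : 0 < k -> k `^ (2 / p - 1) = k `^ (2 / p) / k :> R.
  by move=> k0; rewrite powRB ?powRr1 ?(ltW k0) ?(gt_eqF k0) ?implybT.
(* From gamma n >= 8 (r + 1) and n >= 32 one gets gamma n^2 >= 256 (r + 1). *)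
have rn : r / n%:R ^+ 2 <= gamma / 100.
  have tg : 2 * theta <= gamma.
    rewrite /theta mulrA ler_pdivrMr //.
    by have := ler_wpM2l (ltW g0) hp2; lra.
  have gn : 8 * (r + 1) <= gamma * n%:R.
    by have := ler_wpM2r (ltW n0) tg; lra.
  have n32 : 32 <= n%:R :> R.
    have : gamma * n%:R <= 1 / 4 * n%:R by rewrite ler_pM2r //; lra.
    by lra.
  rewrite ler_pdivrMr ?exprn_gt0 // expr2.
  have := ler_pM _ _ gn n32; rewrite ler0n mulr_ge0 ?addr_ge0 // => /(_ isT isT).
  lra.
have dT : A - r / n%:R ^+ 2 <= density p [set: G].
  apply: le_trans (density_setT (ltW hp1) G0).
  rewrite -(ler_pM2r n0) hG; move: hlambda; rewrite pows //.
  set l := p_spectral_radius _ _; set c := n%:R `^ (2 / p).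
  have -> : (A - r / n%:R ^+ 2) * n%:R = A * n%:R - r / n%:R by field; rewrite gt_eqF.
  by have -> : l * c / n%:R ^+ 2 * n%:R = l * (c / n%:R) by field; rewrite gt_eqF.
have [v0 v0d] := exists_degree_le_min_degree G0.
have v0d' : #|nbrs [set: G] v0|%:R <= (A - gamma) * #|[set: G]%SET|%:R.
  rewrite cardsT hG; apply: le_trans hdelta; rewrite ler_nat; apply: leq_trans v0d.
  by rewrite subset_leq_card //; apply/fintype.subsetP => w; rewrite !inE.
have Tn : #|[set: G]%SET| = n by rewrite cardsT.
have [||||u uT] := density_setD1 hp1 (finset.in_setT v0) hp2
  g0 _ (erefl theta) _ _ _ v0d'.
- lra.
- rewrite Tn; lra.
- lra.
- lra.
rewrite Tn => hu.
have n1 : (0 < n)%N by rewrite -(ltr0n R).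
have mS : #|[set: G] :\ u| = n.-1.
  by have := cardsD1 u [set: G]; rewrite uT Tn => ->.
(* The iteration starts from n - 1 vertices but measures against the original n. *)
have [|||S [Sk Sd Sm]] := @dense_subgraph R p gamma A theta n G ([set: G] :\ u)
  hp1 hp2 g0 hgammaA hA erefl _ _ _.
- lra.
- by rewrite mS leq_pred.
- rewrite mS -subn1 natrB //; apply: lt_le_trans hu.
  rewrite mulrCA [ltLHS]mulrC ltr_pM2l ?powR_gt0 //.
  set x := (n%:R : R)^-1; have x0 : 0 < x by rewrite invr_gt0.
  have xn : n%:R * x = 1 by rewrite mulfV // gt_eqF.
  have -> : theta / (4 * n%:R) = theta * x / 4 by rewrite /x; field; rewrite gt_eqF.
  set q := theta * x / 4; have q0 : 0 < q by rewrite divr_gt0 // mulr_gt0.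
  (* The goal is (A - r x^2)(1 + q) > A. In r + 1, the r pays for the defect r x^2 and the 1 for the
     cross term r q x^2, as r q <= 1. *)
  have Aq : (r + 1) * x ^+ 2 < A * q.
    have := Ant; rewrite -(ltr_pM2r (_ : 0 < x ^+ 2 / 4)) ?divr_gt0 ?exprn_gt0 //.
    have -> : A * n%:R * theta * (x ^+ 2 / 4) = A * q * (n%:R * x) by rewrite /q; ring.
    by rewrite xn; lra.
  have rq : r * q <= 1.
    have : 4 * (r + 1) * x < theta.
      have := nt; rewrite -(ltr_pM2r x0).
      have -> : n%:R * theta * x = theta * (n%:R * x) by ring.
      by rewrite xn mulr1.
    have : x * theta <= x * 1 by rewrite ler_pM2l // ltW.
    have : 0 <= r * x by rewrite mulr_ge0 // ltW.
    rewrite /q => rx0 xt1 rx1.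
    have : r * (x * theta) <= r * (x * 1) by rewrite ler_wpM2l.
    lra.
  have rqx : r * q * x ^+ 2 <= x ^+ 2 by rewrite ler_piMl // exprn_ge0 // ltW.
  have := ler_wpM2r (_ : 0 <= 1 + q) dT; rewrite addr_ge0 ?(ltW q0) // => /(_ isT).
  rewrite -exprVn -/x; lra.
exists S, #|S|; split; rewrite ?eT //; first exact: card_induced.
have k0 : 0 < #|S|%:R :> R by apply: lt_trans Sk; rewrite mulr_gt0.
move: Sd; rewrite /density pows // ltr_pdivlMr ?exprn_gt0 // expr2 => Sd.
by rewrite [X in _ < X]mulrA ltr_pdivlMr // -mulrA.
Qed.
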